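(* Let $R$ be a nonzero associative unital ring, $n$ a positive integer, $G$ a group with identity element $e$, and $\rho$ an equivalence relation on $\overline{n}=\{1,\ldots,n\}$. Then the maps $\Phi:\mathcal{G}(\rho,G,R)\to\mathcal{A}(\rho,G)$ and $\Psi:\mathcal{A}(\rho,G)\to\mathcal{G}(\rho,G,R)$ are mutually inverse.
   Context: Gradings. For $X,Y\subseteq\overline{n}\times\overline{n}$ put $XY=\{(i,k)\mid \exists j\in\overline{n}:\ (i,j)\in X,\ (j,k)\in Y\}$. A $G$-grading on $\rho$ is a family $(\rho_g)_{g\in G}$ of pairwise disjoint (possibly empty) subsets of $\rho$ with $\rho=\bigcup_{g\in G}\rho_g$ and $\rho_g\rho_h\subseteq\rho_{gh}$ for all $g,h\in G$. Let $e_{i,j}$ be the matrix with $1$ in position $(i,j)$ and zeros elsewhere, $S:=M_n(\rho,R)=\sum_{(i,j)\in\rho}Re_{i,j}\subseteq M_n(R)$, and $D:=\bigoplus_{i=1}^nRe_{i,i}$. A $G$-grading $(S_g)_{g\in G}$ on $S$ is very good if there is a $G$-grading $(\rho_g)_{g\in G}$ on $\rho$ with $S_g=\sum_{(i,j)\in\rho_g}Re_{i,j}$ for all $g\in G$. $\mathcal{G}(\rho,G,R)$ is the set of all very good $G$-gradings $(S_g)_{g\in G}$ on $S$ with $S_e=D$. Partial actions. A partial action of $G$ on a set $X$ is a family $\alpha=(X_g,\alpha_g)_{g\in G}$, where $X_g\subseteq X$ and $\alpha_g:X_{g^{-1}}\to X_g$ is a bijection for every $g\in G$, such that (P1) $X_e=X$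 and $\alpha_e=\mathrm{id}_X$; (P2) if $g,h\in G$, $x\in X_{h^{-1}}$ and $\alpha_h(x)\in X_{g^{-1}}$, then $x\in X_{(gh)^{-1}}$ and $\alpha_{gh}(x)=\alpha_g(\alpha_h(x))$. It is free if, whenever $x\in X_{g^{-1}}\cap X_{h^{-1}}$ and $\alpha_g(x)=\alpha_h(x)$, one has $g=h$. Its orbit equivalence relation is: $i\sim_\alpha j$ if and only if $\alpha_g(j)=i$ for some $g\in G$ with $j\in X_{g^{-1}}$. $\mathcal{A}(\rho,G)$ is the set of all free partial actions of $G$ on $\overline{n}$ whose orbit equivalence relation is $\rho$. The maps (both well defined). For $\mathcal{S}=(S_g)_{g\in G}\in\mathcal{G}(\rho,G,R)$ and $g\in G$ put $\rho_g^{\mathcal{S}}=\{(i,j)\in\rho\mid e_{i,j}\in S_g\}$ and $X_g^{\mathcal{S}}=\{i\in\overline{n}\mid (i,j)\in\rho_g^{\mathcal{S}}\text{ for some }j\in\overline{n}\}$, and let $\alpha_g^{\mathcal{S}}:X_{g^{-1}}^{\mathcal{S}}\to X_g^{\mathcal{S}}$ be given by $\alpha_g^{\mathcal{S}}(j)=i\Leftrightarrow(i,j)\in\rho_g^{\mathcal{S}}$; then $\Phi(\mathcal{S}):=(X_g^{\mathcal{S}},\alpha_g^{\mathcal{S}})_{g\in G}$. For $\alpha=(X_g,\alpha_g)_{g\in G}\in\mathcal{A}(\rho,G)$, $\Psi(\alpha):=(S_g^\alpha)_{g\in G}$ with $S_g^\alpha:=\bigoplus_{j\in X_{g^{-1}}}Re_{\alpha_g(j),j}$.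 *)

(* Defs.v *)
From HB Require Import structures.
From mathcomp Require Export all_boot all_order all_algebra generic_quotient.
From mathcomp Require Export boolp classical_sets.

Set Implicit Arguments.
Unset Strict Implicit.
Unset Printing Implicit Defensive.

Import GRing.Theory.

Local Open Scope ring_scope.
Local Open Scope classical_set_scope.

Definition graph (T : Type) (rho : rel T) : set (T * T) :=
  [set p | rho p.1 p.2].

Definition diagonal (T : Type) : set (T * T) := range (fun i : T => (i, i)).
Arguments diagonal T : clear implicits.

(* The product XY of two relations, X being traversed first, is [Y \; X]. *)
Definition rel_grading (G : groupType) (T : Type) (rho : set (T * T))
    (rhog : G -> set (T * T)) : Prop :=
  [/\ trivIset setT rhog,
      rho = \bigcup_g rhog g
    & forall g h : G, (rhog h \; rhog g)%relation `<=` rhog (g * h)%g].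

(* The second and third clauses say that S is the internal direct sum of the
   additive subgroups Sg g; the sums are finite whatever the size of G. *)
Definition ring_grading (G : groupType) (A : pzRingType) (S : set A)
    (Sg : G -> set A) : Prop :=
  [/\ forall g, zmod_closed (mem (Sg g)),
      S = [set x | exists (s : seq G) (f : G -> A),
             (forall g, Sg g (f g)) /\ x = \sum_(g <- s) f g],
      forall (s : seq G) (f : G -> A), uniq s -> (forall g, Sg g (f g)) ->
        \sum_(g <- s) f g = 0 -> {in s, forall g, f g = 0}
    & forall g h x y, Sg g x -> Sg h y -> Sg (g * h)%g (x * y)].

(* The sum of the R e_(i,j) over (i,j) in P. *)
Definition Rspan (R : nzRingType) (n : nat) (P : set ('I_n * 'I_n)) :
    set 'M[R]_n :=
  [set A | exists c : 'I_n * 'I_n -> R,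
     A = \sum_(p | p \in P) c p *: delta_mx p.1 p.2].
Arguments Rspan R {n} P _.

Definition very_good_grading (G : groupType) (R : nzRingType) (n : nat)
    (rho : rel 'I_n) (Sg : G -> set 'M[R]_n) : Prop :=
  ring_grading (Rspan R (graph rho)) Sg /\
  exists2 rhog : G -> set ('I_n * 'I_n),
    rel_grading (graph rho) rhog & forall g, Sg g = Rspan R (rhog g).

Definition very_good_gradings (G : groupType) (R : nzRingType) (n : nat)
    (rho : rel 'I_n) : Type :=
  {Sg : G -> set 'M[R]_n |
    very_good_grading rho Sg /\ Sg 1%g = Rspan R (diagonal 'I_n)}.

(* Sets of points are coerced to subtypes, so [pact g] is a map from X_(g^-1)
   to X_g.  In [pact_comp], y is h.x as an element of X_(g^-1), and the witness
   z is x as an element of X_((gh)^-1). *)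
Record partial_action (G : groupType) (T : Type) := PartialAction {
  pdom : G -> set T;
  pact : forall g : G, pdom g^-1%g -> pdom g;
  pact_bij : forall g, bijective (@pact g);
  pdom1 : pdom 1%g = setT;
  pact1 : forall x : pdom 1^-1%g, val (pact x) = val x;
  pact_comp : forall (g h : G) (x : pdom h^-1%g) (y : pdom g^-1%g),
    val (pact x) = val y ->
    exists z : pdom (g * h)^-1%g, val z = val x /\ val (pact z) = val (pact y)
}.
Arguments pact {G T} p g _ : rename.

Definition free_action (G : groupType) (T : Type) (a : partial_action G T) :
    Prop :=
  forall (g h : G) (x : pdom a g^-1%g) (y : pdom a h^-1%g),
    val x = val y -> val (pact a g x) = val (pact a h y) -> g = h.

Definition orbit_rel (G : groupType) (T : Type) (a : partial_action G T)
    (i j : T) : Prop :=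
  exists (g : G) (x : pdom a g^-1%g), val x = j /\ val (pact a g x) = i.

Definition free_partial_actions (G : groupType) (n : nat) (rho : rel 'I_n) :
    Type :=
  {a : partial_action G 'I_n |
    free_action a /\ forall i j, orbit_rel a i j <-> rho i j}.

Lemma RspanP (R : nzRingType) n (P : set ('I_n * 'I_n)) (A : 'M[R]_n) :
  Rspan R P A <-> forall i j, ~ P (i, j) -> A i j = 0.
Proof.
split=> [[c ->] i j Pij|A0].
  rewrite summxE big1 // => -[k l] /set_mem Pkl; rewrite !mxE /=.
  case: eqP => [ik|]; case: eqP => [jl|] /=; rewrite ?mulr0 //.
  by case: Pij; rewrite ik jl.
exists (fun p => A p.1 p.2); apply/matrixP=> i j; rewrite summxE.
have [Pij|Pij] := boolP ((i, j) \in P).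
  rewrite (bigD1 (i, j)) //= !mxE !eqxx mulr1 big1 ?addr0 // => -[k l] /= /andP[_].
  rewrite !mxE xpair_eqE (eq_sym k) (eq_sym l).
  by case: eqP; case: eqP; rewrite ?mulr0.
rewrite A0; last by move=> /mem_set; apply/negP.
rewrite big1 // => -[k l] Pkl; rewrite !mxE /=.
case: eqP => [ik|]; case: eqP => [jl|] /=; rewrite ?mulr0 //.
by move: Pij; rewrite ik jl Pkl.
Qed.

Lemma Rspan_delta (R : nzRingType) n (P : set ('I_n * 'I_n)) i j :
  Rspan R P (delta_mx i j) <-> P (i, j).
Proof.
rewrite RspanP; split=> [P0|Pij k l Pkl].
  apply: contrapT => /P0; rewrite mxE !eqxx => /eqP.
  by rewrite oner_eq0.
rewrite mxE; case: eqP => [ki|]; case: eqP => [lj|] //=.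
by case: Pkl; rewrite ki lj.
Qed.

Lemma Rspan_grading (G : groupType) (R : nzRingType) n
    (rho : set ('I_n * 'I_n)) (rhog : G -> set ('I_n * 'I_n)) :
  rel_grading rho rhog ->
  ring_grading (Rspan R rho) (fun g => Rspan R (rhog g)).
Proof.
case=> disj rhoE rhogM.
have uni g h p : rhog g p -> rhog h p -> g = h.
  by move=> gp hp; apply: disj => //; exists p.
split.
- move=> g; split; first by apply/mem_set/RspanP => i j _; rewrite mxE.
  move=> u v /set_mem/RspanP u0 /set_mem/RspanP v0.
  by apply/mem_set/RspanP => i j Pij; rewrite !mxE u0 // v0 // subr0.
- apply/seteqP; split=> [A /RspanP A0|A [s [f [fP ->]]]]; last first.
    apply/RspanP => i j Pij; rewrite summxE big1 // => g _.
    have /RspanP := fP g; apply=> gij; apply: Pij.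
    by rewrite rhoE; exists g.
  have /choice[d dP] : forall p, exists g, rho p -> rhog g p.
    move=> p; case: (pselect (rho p)) => [|rp]; last by exists 1%g.
    by rewrite {1}rhoE => -[g _ gp]; exists g.
  exists (undup [seq d p | p <- enum {: 'I_n * 'I_n}]).
  exists (fun g => \matrix_(i, j) if (i, j) \in rhog g then A i j else 0).
  split=> [g|].
    apply/RspanP=> i j gij; rewrite mxE ifN //.
    by apply/negP => /set_mem.
  apply/matrixP=> i j; rewrite summxE.
  case: (pselect (rho (i, j))) => rij; last first.
    by rewrite A0 // big1 // => g _; rewrite mxE A0 //; case: ifP.
  rewrite (bigD1_seq (d (i, j))) ?undup_uniq //=; last first.
    by rewrite mem_undup; apply: map_f; rewrite mem_enum.
  rewrite mxE mem_set ?big1 ?addr0 //; last exact: dP.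
  move=> g /eqP gd; rewrite mxE ifN //; apply/negP => /set_mem gij.
  by apply: gd; apply: uni gij (dP _ _).
- move=> s f us fP f0 g gs; apply/matrixP => i j; rewrite mxE.
  case: (pselect (rhog g (i, j))) => gij; last first.
    by have /RspanP := fP g; apply.
  have := congr1 (fun M : 'M_n => M i j) f0.
  rewrite summxE mxE (bigD1_seq g) //= big1 ?addr0 // => h /eqP hg.
  have /RspanP := fP h; apply=> hij; apply: hg; exact: uni hij gij.
- move=> g h x y /RspanP x0 /RspanP y0; apply/RspanP => i k Pik.
  rewrite mxE big1 // => j _.
  case: (pselect (rhog g (i, j))) => [gij|/x0->]; last by rewrite mul0r.
  case: (pselect (rhog h (j, k))) => [hjk|/y0->]; last by rewrite mulr0.
  by case: Pik; apply: rhogM; exists j.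
Qed.

(* rho_g^S and X_g^S. *)
Definition rel_of_grading (G : groupType) (R : nzRingType) n (rho : rel 'I_n)
    (Sg : G -> set 'M[R]_n) (g : G) : set ('I_n * 'I_n) :=
  [set p | rho p.1 p.2 /\ Sg g (delta_mx p.1 p.2)].

Definition dom_of_grading (G : groupType) (R : nzRingType) n (rho : rel 'I_n)
    (Sg : G -> set 'M[R]_n) (g : G) : set 'I_n :=
  [set i | exists j, rel_of_grading rho Sg g (i, j)].

Section Phi.

Variables (G : groupType) (R : nzRingType) (n : nat) (rho : equiv_rel 'I_n).
Variable S : very_good_gradings G R rho.

Let Q := rel_of_grading rho (sval S).
Let X := dom_of_grading rho (sval S).

Lemma rel_of_gradingP : rel_grading (graph rho) Q /\ Q 1%g = diagonal 'I_n.
Proof.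
rewrite /Q; case: S => Sg /= [[_ [q qP SgE] S1]].
have sub g : q g `<=` graph rho.
  by move=> p gp; case: qP => _ -> _; exists g.
have -> : rel_of_grading rho Sg = q.
  apply/funext => g; apply/seteqP; split=> -[i j].
    by move=> [_] /=; rewrite SgE Rspan_delta.
  by move=> gij; split; [exact: sub gij | rewrite SgE Rspan_delta].
split=> //; apply/seteqP; split=> -[i j] ij.
  by apply/(Rspan_delta R); rewrite -S1 SgE Rspan_delta.
by apply/(Rspan_delta R); rewrite -SgE S1 Rspan_delta.
Qed.

Let Q1 i j : Q 1%g (i, j) <-> i = j.
Proof.
have [_ ->] := rel_of_gradingP.
by split=> [[k _ [<- <-]]|->] //; exists j.
Qed.

Let Qu g h i j : Q g (i, j) -> Q h (i, j) -> g = h.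
Proof.
by have [[disj _ _] _] := rel_of_gradingP => gi hi; apply: disj => //; exists (i, j).
Qed.

Let QM g h i j k : Q g (i, j) -> Q h (j, k) -> Q (g * h)%g (i, k).
Proof.
by have [[_ _ QM] _] := rel_of_gradingP => gi hi; apply: QM; exists j.
Qed.

Let Qrho i j : rho i j -> exists g, Q g (i, j).
Proof.
have [[_ rhoE _] _] := rel_of_gradingP => ij.
have : graph rho (i, j) by [].
by rewrite rhoE => -[g _ gij]; exists g.
Qed.

Let QV g i j : Q g (i, j) -> Q g^-1%g (j, i).
Proof.
move=> gij; have [h hji] : exists h, Q h (j, i).
  by apply: Qrho; rewrite equiv_sym; case: gij.
have Qii : Q 1%g (i, i) by apply/Q1.
by have /mulg1_eq-> := Qu (QM gij hji) Qii.
Qed.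

Let Qinjl g i i' j : Q g (i, j) -> Q g (i', j) -> i = i'.
Proof. by move=> ij /QV/(QM ij); rewrite mulgV => /Q1. Qed.

Let Qinjr g i j j' : Q g (i, j) -> Q g (i, j') -> j = j'.
Proof. by move=> /QV ij /QV ij'; exact: Qinjl ij ij'. Qed.

Let Qex g (j : X g^-1%g) : exists i : X g, Q g (val i, val j).
Proof.
case: j => j /= jX; have [k /QV] := set_mem jX; rewrite invgK => gkj.
have kX : k \in X g by apply/mem_set; exists j.
by exists (exist _ k kX).
Qed.

(* The i in X_g with (i,j) in rho_g; it is unique, see [phi_actP]. *)
Definition phi_act (g : G) (j : X g^-1%g) : X g := sval (cid (Qex j)).

Lemma phi_actP g (j : X g^-1%g) (i : X g) :
  phi_act j = i <-> Q g (val i, val j).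
Proof.
rewrite /phi_act; case: cid => k /= kj; split=> [<-//|ij].
exact/val_inj/(Qinjl kj ij).
Qed.

Let phi_actQ g (j : X g^-1%g) : Q g (val (phi_act j), val j).
Proof. exact/phi_actP. Qed.

Let inX g i j : Q g (i, j) -> i \in X g.
Proof. by move=> gij; apply/mem_set; exists j. Qed.

Let inXV g i j : Q g (i, j) -> j \in X g^-1%g.
Proof. by move=> /QV; exact: inX. Qed.

Lemma phi_bij g : bijective (@phi_act g).
Proof.
have /choice[f fP] : forall i : X g, exists j, phi_act j = i.
  case=> i iX; have [j gij] := set_mem iX.
  by exists (exist _ j (inXV gij)); apply/phi_actP.
exists f => // j; apply: val_inj.
by have /phi_actP/= := fP (phi_act j) => h; exact: Qinjr h (phi_actQ j).
Qed.

Lemma phi_dom1 : X 1%g = setT.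
Proof. by apply/seteqP; split=> // i _; exists i; apply/Q1. Qed.

Lemma phi_act1 (x : X 1^-1%g) : val (phi_act x) = val x.
Proof. exact/Q1/phi_actQ. Qed.

Lemma phi_comp (g h : G) (x : X h^-1%g) (y : X g^-1%g) :
  val (phi_act x) = val y ->
  exists z : X (g * h)^-1%g,
    val z = val x /\ val (phi_act z) = val (phi_act y).
Proof.
move=> xy; have hx := phi_actQ x; rewrite xy in hx.
have ghx := QM (phi_actQ y) hx.
pose z : X (g * h)^-1%g := exist _ (val x) (inXV ghx).
by exists z; split=> //; exact: (Qinjl (phi_actQ z) ghx).
Qed.

Definition phi_action : partial_action G 'I_n :=
  PartialAction phi_bij phi_dom1 phi_act1 phi_comp.

Lemma phi_actionP :
  free_action phi_action /\ forall i j, orbit_rel phi_action i j <-> rho i j.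
Proof.
split=> [g h x y /= xy|i j].
  have gx := phi_actQ x; have hy := phi_actQ y.
  move=> e; apply: (Qu gx).
  exact: (eq_ind_r (Q h) hy (congr2 pair e xy)).
split=> [[g [x [<- <-]]]|/Qrho[g gij]].
  by have [] := phi_actQ x.
pose x : X g^-1%g := exist _ j (inXV gij).
by exists g, x; split=> //; exact: (Qinjl (phi_actQ x) gij).
Qed.

Definition Phi : free_partial_actions G rho := exist _ phi_action phi_actionP.

End Phi.

(* S_g^alpha. *)
Definition psi_grading (G : groupType) (R : nzRingType) n
    (a : partial_action G 'I_n) (g : G) : set 'M[R]_n :=
  Rspan R (range (fun j : pdom a g^-1%g => (val (pact a g j), val j))).
Arguments psi_grading {G} R {n} a g _.

Section Psi.

Variables (G : groupType) (R : nzRingType) (n : nat) (rho : equiv_rel 'I_n).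
Variable a : free_partial_actions G rho.

Lemma psi_gradingP :
  very_good_grading rho (psi_grading R (sval a)) /\
  psi_grading R (sval a) 1%g = Rspan R (diagonal 'I_n).
Proof.
case: a => b /= [bfree borb].
pose q g := range (fun j : pdom b g^-1%g => (val (pact b g j), val j)).
have qP : rel_grading (graph rho) q.
  split=> [g h _ _ [p [[x _ xp] [y _ yp]]]||g h].
  - by move: yp; rewrite -xp => -[e1 e2]; apply: (bfree _ _ x y).
  - apply/seteqP; split=> -[i j].
      by rewrite /graph /= => /borb[g [x [<- <-]]]; exists g => //; exists x.
    by move=> [g _ [x _ [<- <-]]]; apply/borb; exists g, x.
  - move=> [i k] /= [j [y _ [<- yj]] [x _ [xj <-]]].
    have [|z [zx zy]] := @pact_comp _ _ b g h x y; first exact: etrans xj (esym yj).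
    by exists z => //; exact: congr2 zy zx.
split; first split.
- exact: Rspan_grading.
- by exists q.
- rewrite /psi_grading; congr (Rspan R _); apply/seteqP; split=> [_ [x _ <-]|_ [i _ <-]].
    by exists (val x) => //; rewrite pact1.
  have iX : i \in pdom b 1^-1%g by apply/mem_set; rewrite invg1 pdom1.
  by exists (exist _ i iX) => //; rewrite pact1.
Qed.

Definition Psi : very_good_gradings G R rho :=
  exist _ (psi_grading R (sval a)) psi_gradingP.

End Psi.

Arguments Phi {G R n rho} S.
Arguments Psi {G} R {n rho} a.

(* Main.v *)
(* Very good gradings and free partial actions both encode the same
   decomposition of rho into pieces rho_g: the matrix units spanning S_g are
   indexed by rho_g, and rho_g is the graph of alpha_g.  Each of Phi and Psi
   preserves this decomposition, which in turn determines the grading (as the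
   span of its matrix units) and the action (as the maps with these graphs). *)
Require Import Defs.

Local Open Scope classical_set_scope.

(** The types of the maps depend on the domains, so until these are identified only underlying
    points can be compared; the other fields are proofs. *)
Lemma eq_partial_action (G : groupType) (T : Type) (a b : partial_action G T) :
  pdom a = pdom b ->
  (forall g (x : pdom a g^-1%g) (y : pdom b g^-1%g),
     val x = val y -> val (pact a g x) = val (pact b g y)) ->
  a = b.
Proof.
case: a => X f fbij X1 f1 fM; case: b => Y h hbij Y1 h1 hM /= XY.
case: Y / XY h hbij Y1 h1 hM => h hbij Y1 h1 hM fh.
have {}fh : f = h.
  by apply: functional_extensionality_dep => g; apply/funext => x;
    apply/val_inj/fh.
case: h / fh hbij h1 hM => hbij h1 hM.
by congr PartialAction; exact: Prop_irrelevance.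
Qed.

(* That the range is all of rho_g is read off the orbit relation of Phi S and
   the disjointness of the pieces. *)
Lemma range_phi_act (G : groupType) (R : nzRingType) n (rho : equiv_rel 'I_n)
    (S : very_good_gradings G R rho) (g : G) :
  range (fun j => (val (@phi_act _ _ _ _ S g j), val j)) =
  rel_of_grading rho (sval S) g.
Proof.
apply/seteqP; split=> [_ [j _ <-]|[i j] gij]; first exact/phi_actP.
have [[disj _ _] _] := rel_of_gradingP S.
have [_ /(_ i j)[_ /(_ gij.1)[h [x [xj xi]]]]] := phi_actionP S.
have hij : rel_of_grading rho (sval S) h (i, j).
  by rewrite -xj -xi; exact/phi_actP.
have hg : h = g by apply: disj => //; exists (i, j).
by case: g / hg {gij}; exists x => //; exact: congr2 xi xj.
Qed.

(** Since 1 is nonzero in [R], a matrix unit lies in a span only if its position is one of those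
    spanned, so [Sg g] determines [q g]. *)
Lemma Rspan_rel_of_grading (G : groupType) (R : nzRingType) n
    (rho : equiv_rel 'I_n) (S : very_good_gradings G R rho) (g : G) :
  Rspan R (rel_of_grading rho (sval S) g) = sval S g.
Proof.
case: S => Sg /= [[_ [q [_ rhoE _] SgE]] _].
rewrite [RHS]SgE; congr (Rspan R _); apply/seteqP; split=> -[i j].
  by move=> [_] /=; rewrite SgE Rspan_delta.
move=> gij; split; last by rewrite SgE Rspan_delta.
by change (graph rho (i, j)); rewrite rhoE; exists g.
Qed.

Lemma rel_of_psi_grading (G : groupType) (R : nzRingType) n
    (rho : equiv_rel 'I_n) (a : free_partial_actions G rho) (g : G) :
  rel_of_grading rho (psi_grading R (sval a)) g =
  range (fun j => (val (pact (sval a) g j), val j)).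
Proof.
case: a => b /= [_ borb]; apply/seteqP; split=> [[i j] [_] /Rspan_delta //|].
move=> _ [x _ <-]; split; first by apply/borb; exists g, x.
by apply/Rspan_delta; exists x.
Qed.

Lemma PhiK (G : groupType) (R : nzRingType) n (rho : equiv_rel 'I_n) :
  cancel (@Phi G R n rho) (@Psi G R n rho).
Proof.
move=> S; apply: eq_sig_hprop => [? ? ?|]; first exact: Prop_irrelevance.
apply/funext => g.
by rewrite /= /psi_grading range_phi_act Rspan_rel_of_grading.
Qed.

Lemma PsiK (G : groupType) (R : nzRingType) n (rho : equiv_rel 'I_n) :
  cancel (@Psi G R n rho) (@Phi G R n rho).
Proof.
move=> a; apply: eq_sig_hprop => [? ? ?|]; first exact: Prop_irrelevance.
have relE := @rel_of_psi_grading _ R _ _ a.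
apply: eq_partial_action => [|g x y xy] /=.
  apply/funext => g; apply/seteqP; split=> i.
    by move=> [j]; rewrite relE => -[x _ [<- _]]; exact: set_valP.
  (* Surjectivity of [pact (sval a) g] yields a preimage of [i]. *)
  move=> gi; have [f _ fK] := pact_bij (sval a) g.
  pose x := f (exist _ i (mem_set gi)).
  by exists (val x); rewrite relE; exists x => //; rewrite fK.
(* Read through [phi_actP], this trivial equation puts the pair of [phi_act x] and [x] on the graph
   of [pact (sval a) g], over a point [z] equal to [y]. *)
have /phi_actP : phi_act x = phi_act x by [].
rewrite relE => -[z _ [<- zx]].
by congr (val (pact _ _ _)); apply/val_inj; exact: etrans zx xy.
Qed.

Theorem theorem32 (R : nzRingType) (n : nat) (n_gt0 : (0 < n)%N)
    (G : groupType) (rho : equiv_rel 'I_n) :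
  cancel (Phi : very_good_gradings G R rho -> free_partial_actions G rho)
         (Psi R : free_partial_actions G rho -> very_good_gradings G R rho)
  /\
  cancel (Psi R : free_partial_actions G rho -> very_good_gradings G R rho)
         (Phi : very_good_gradings G R rho -> free_partial_actions G rho).
Proof. by split; [exact: PhiK | exact: PsiK]. Qed.
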